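(* Let $F\colon\mathcal C\to\mathcal D$ be a functor between small categories, let $\mathcal O$ be an orbit family for $\mathcal D$ and $\mathcal P$ an orbit family for $\mathcal C$, and suppose that $F^*\mathcal O\subseteq\mathcal P$, i.e. $F^*\mathbb T\in\mathcal P$ for every $\mathbb T\in\mathcal O$. Then, for every $\mathcal D$-space $\mathbb X$, \[ \mathrm{cat}_{\mathcal C}^{\mathcal P}(F^*\mathbb X)\leq\mathrm{cat}_{\mathcal D}^{\mathcal O}(\mathbb X). \]
   Context: $\mathrm{Top}$ is the category of compactly generated topological spaces; products and subspaces are taken in compactly generated spaces. For a small category $\mathcal C$, a $\mathcal C$-space is a functor $\mathbb X\colon\mathcal C\to\mathrm{Top}$; a $\mathcal C$-map is a natural transformation. Products are objectwise; a space $K$ is also regarded as a constant $\mathcal C$-space; $\mathbb I=[0,1]$. A $\mathcal C$-homotopy from $f$ to $g$ (with $f,g\colon\mathbb X\to\mathbb Y$) is a $\mathcal C$-map $H\colon\mathbb X\times\mathbb I\to\mathbb Y$ with $H_0=f$, $H_1=g$; then write $f\simeq_{\mathcal C}g$. For $F\colon\mathcal C\to\mathcal D$ and a $\mathcal D$-space $\mathbb X$, $F^*\mathbb X=\mathbb X\circ F$. A topological $\mathcal C$-orbit is a $\mathcal C$-space $\mathbb T$ with $\varinjlim_{\mathcal C}\mathbb T\cong *$ (colimit in $\mathrm{Top}$). An orbit family for $\mathcal C$ is a class $\mathcal O$ of topological $\mathcal C$-orbits, closed under isomorphism and containing every representable $\mathcal C(c,-)$, regarded as an objectwise discrete $\mathcal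 C$-space. An open $\mathcal C$-subspace $\mathbb U\subseteq\mathbb X$ is a family of open subspaces $\mathbb U(c)\subseteq\mathbb X(c)$ stable under the structure maps (with restricted structure maps); $\iota_{\mathbb U}\colon\mathbb U\hookrightarrow\mathbb X$ is the inclusion. An open cover of $\mathbb X$ is a collection $\{\mathbb U_i\}$ of open $\mathcal C$-subspaces with $\mathbb X(c)=\bigcup_i\mathbb U_i(c)$ for every object $c$. $\mathbb U$ is $\mathcal O$-categorical in $\mathbb X$ if there are $\mathbb T\in\mathcal O$ and $\mathcal C$-maps $a\colon\mathbb U\to\mathbb T$, $O\colon\mathbb T\to\mathbb X$ with $\iota_{\mathbb U}\simeq_{\mathcal C}O\circ a$. $\mathrm{cat}_{\mathcal C}^{\mathcal O}(\mathbb X)$ is the least integer $n\ge0$ such that $\mathbb X$ has an open cover $\{\mathbb U_0,\dots,\mathbb U_n\}$ by $\mathcal O$-categorical open $\mathcal C$-subspaces ($\infty$ if none exists). *)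

(* Defs.v *)
From HB Require Import structures.
From mathcomp Require Import all_boot all_order all_algebra.
From mathcomp Require Import all_classical all_reals all_analysis.
Set Implicit Arguments.
Unset Strict Implicit.
Unset Printing Implicit Defensive.

Import Order.TTheory GRing.Theory Num.Theory.
Import numFieldNormedType.Exports.

Local Open Scope classical_set_scope.
Local Open Scope ring_scope.

(* "Compactly generated" means k-space: the topology is final with respect to
   all continuous maps from compact Hausdorff spaces.  No separation axiom is
   imposed on the space itself. *)
Definition k_open (X : topologicalType) (A : set X) : Prop :=
  forall (K : topologicalType) (f : K -> X),
    compact [set: K] -> hausdorff_space K -> continuous f -> open (f @^-1` A).

HB.mixin Record isCompactlyGenerated T & Topological T := {
  k_open_open : forall A : set T, k_open A -> open A
}.

#[short(type="cgType")]
HB.structure Definition CompactlyGenerated :=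
  { T of Topological T & isCompactlyGenerated T }.

(* The same points, with the k-open sets as open sets.  Products and subspaces
   in compactly generated spaces are the k-ified ones. *)
Definition kify (X : Type) : Type := X.

Section Kify.
Variable X : topologicalType.

Local Lemma k_openT : k_open [set: X].
Proof. by move=> K f _ _ _; rewrite preimage_setT; exact: openT. Qed.

Local Lemma k_openI : setI_closed (@k_open X).
Proof.
move=> A B kA kB K f cK hK cf.
by rewrite preimage_setI; apply: openI; [exact: kA | exact: kB].
Qed.

Local Lemma k_open_bigcup (I : Type) (g : I -> set X) :
  (forall i, k_open (g i)) -> k_open (\bigcup_i g i).
Proof.
move=> kg K f cK hK cf; rewrite preimage_bigcup.
by apply: bigcup_open => i _; exact: kg.
Qed.

HB.instance Definition _ := Choice.on (kify X).
HB.instance Definition _ :=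
  isOpenTopological.Build (kify X) k_openT k_openI k_open_bigcup.

Lemma kify_openE (A : set X) : open (A : set (kify X)) = k_open A.
Proof. by []. Qed.

Lemma continuous_kify (K : topologicalType) (f : K -> X) :
  compact [set: K] -> hausdorff_space K -> continuous f ->
  continuous (f : K -> kify X).
Proof. by move=> cK hK cf; apply/continuousP => A kA; exact: kA. Qed.

Lemma kify_id_continuous : continuous (id : kify X -> X).
Proof.
apply/continuousP => A oA.
by rewrite kify_openE => K f _ _ /continuousP cf; exact: cf.
Qed.

Local Lemma kify_cg (A : set (kify X)) : k_open A -> open A.
Proof.
move=> kA; rewrite kify_openE => K f cK hK cf.
exact: (kA K f cK hK (continuous_kify cK hK cf)).
Qed.

HB.instance Definition _ := isCompactlyGenerated.Build (kify X) kify_cg.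

End Kify.

Lemma kify_continuous (X Y : topologicalType) (f : X -> Y) :
  continuous f -> continuous (f : kify X -> kify Y).
Proof.
move=> cf; apply/continuousP => A; rewrite !kify_openE => kA K g cK hK cg.
by apply: (kA K (f \o g)) => // x;
  apply: continuous_comp; [exact: cg | exact: cf].
Qed.

Section DiscreteCG.
Variable T : choiceType.

Local Lemma discrete_cg (A : set (discrete_topology T)) : k_open A -> open A.
Proof. by move=> _; exact: discrete_open. Qed.

HB.instance Definition _ :=
  isCompactlyGenerated.Build (discrete_topology T) discrete_cg.

End DiscreteCG.

Definition one_point : cgType := discrete_topology unit.

Definition itv01 (R : realType) : set R := `[0, 1]%classic.
Arguments itv01 : clear implicits.

Definition unit_interval (R : realType) : Type := set_type (itv01 R).

Section UnitInterval.
Variable R : realType.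

HB.instance Definition _ :=
  Topological.copy (unit_interval R) (set_type (itv01 R)).

Local Lemma val_continuous : continuous (set_val : unit_interval R -> R).
Proof. exact: initial_continuous. Qed.

Lemma unit_interval_hausdorff : hausdorff_space (unit_interval R).
Proof.
move=> x y xy; apply: val_inj; apply: (@norm_hausdorff _ R) => A B nA nB.
have [z [Az Bz]] := xy _ _ (val_continuous nA) (val_continuous nB).
by exists (set_val z).
Qed.

Lemma unit_interval_compact : compact [set: unit_interval R].
Proof.
move=> F PF _.
have GF : ProperFilter (set_val @ F) by exact: fmap_proper_filter.
have G01 : (set_val @ F) (itv01 R).
  rewrite nbhs_simpl /=; apply: filterS filterT => x _ /=.
  exact: (set_valP x).
have [p [p01 clp]] := @segment_compact R 0 1 _ GF G01.
exists (SigSub (mem_set p01) : unit_interval R); split => // A B FA nB.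
have [B' [oB' B'p sB'B]] : exists B' : set R,
    [/\ open B', B' p & set_val @^-1` B' `<=` B].
  by case: nB => _ [[B' oB' <-] /= B'p sB]; exists B'.
have GA : (set_val @ F) (set_val @` A).
  by rewrite nbhs_simpl; apply: (@filterS _ F _ A) FA => x Ax; exists x.
have [_ [[x Ax <-] B'x]] := clp _ _ GA (open_nbhs_nbhs (conj oB' B'p)).
by exists x; split => //; exact: sB'B.
Qed.

Local Lemma unit_interval_cg (A : set (unit_interval R)) : k_open A -> open A.
Proof.
move=> kA; rewrite -[A]preimage_id.
apply: (kA _ id unit_interval_compact unit_interval_hausdorff).
by move=> x; exact: cvg_id.
Qed.

HB.instance Definition _ :=
  isCompactlyGenerated.Build (unit_interval R) unit_interval_cg.

Local Lemma mem0 : (0 : R) \in itv01 R.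
Proof. by apply/mem_set; rewrite /itv01 /= in_itv /= lexx ler01. Qed.

Local Lemma mem1 : (1 : R) \in itv01 R.
Proof. by apply/mem_set; rewrite /itv01 /= in_itv /= lexx ler01. Qed.

Definition I0 : unit_interval R := SigSub mem0.
Definition I1 : unit_interval R := SigSub mem1.

End UnitInterval.

Definition homeomorphic (X Y : topologicalType) : Prop :=
  exists (f : continuousType X Y) (g : continuousType Y X),
    cancel f g /\ cancel g f.

Record category := Category {
  ob :> Type;
  mor : ob -> ob -> Type;
  idm : forall a, mor a a;
  compm : forall a b c, mor b c -> mor a b -> mor a c;
  comp1m : forall a b (f : mor a b), compm (idm b) f = f;
  compm1 : forall a b (f : mor a b), compm f (idm a) = f;
  compmA : forall a b c d (h : mor c d) (g : mor b c) (f : mor a b),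
    compm h (compm g f) = compm (compm h g) f
}.

Record functor (C D : category) := Functor {
  fun_ob :> C -> D;
  fun_map : forall a b : C, mor a b -> mor (fun_ob a) (fun_ob b);
  fun_map1 : forall a : C, fun_map (idm a) = idm (fun_ob a);
  fun_mapM : forall (a b c : C) (g : mor b c) (f : mor a b),
    fun_map (compm g f) = compm (fun_map g) (fun_map f)
}.

Record cspace (C : category) := CSpace {
  sp :> C -> cgType;
  smap : forall a b : C, mor a b -> continuousType (sp a) (sp b);
  smap1 : forall (a : C) (x : sp a), smap (idm a) x = x;
  smapM : forall (a b c : C) (g : mor b c) (f : mor a b) (x : sp a),
    smap (compm g f) x = smap g (smap f x)
}.

Record cmap (C : category) (X Y : cspace C) := CMap {
  cmap_fun :> forall c : C, continuousType (X c) (Y c);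
  cmap_nat : forall (a b : C) (f : mor a b) (x : X a),
    cmap_fun b (smap X f x) = smap Y f (cmap_fun a x)
}.

Section CSpaces.
Variable C : category.

Section Comp.
Variables (X Y Z : cspace C) (g : cmap Y Z) (f : cmap X Y).

Local Definition cmap_comp_fun (c : C) :
  continuousType (X c) (Z c) := g c \o f c.

Local Lemma cmap_comp_nat (a b : C) (h : mor a b) (x : X a) :
  cmap_comp_fun b (smap X h x) = smap Z h (cmap_comp_fun a x).
Proof. by rewrite /cmap_comp_fun /= !cmap_nat. Qed.

Definition cmap_comp : cmap X Z := CMap cmap_comp_nat.
End Comp.

Definition cspace_iso (X Y : cspace C) : Prop :=
  exists (f : cmap X Y) (g : cmap Y X),
    forall c, cancel (f c) (g c) /\ cancel (g c) (f c).

Definition const_cspace (K : cgType) : cspace C :=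
  @CSpace C (fun=> K) (fun _ _ _ => idfun) (fun _ _ => erefl)
    (fun _ _ _ _ _ _ => erefl).

Section Prod.
Variables X Y : cspace C.

Local Definition prod_sp (c : C) : cgType := kify (X c * Y c)%type.

Local Definition prod_fun (a b : C) (f : mor a b) (p : prod_sp a) : prod_sp b :=
  (smap X f p.1, smap Y f p.2).

Local Lemma prod_fun_continuous (a b : C) (f : mor a b) :
  continuous (prod_fun f).
Proof.
apply: (@kify_continuous (X a * Y a)%type (X b * Y b)%type (prod_fun f)).
move=> p; apply: cvg_pair.
  apply: (@continuous_comp _ _ _ fst (smap X f)); first exact: cvg_fst.
  exact: cts_fun.
apply: (@continuous_comp _ _ _ snd (smap Y f)); first exact: cvg_snd.
exact: cts_fun.
Qed.

Local Definition prod_smap (a b : C) (f : mor a b) :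
  continuousType (prod_sp a) (prod_sp b) :=
  mkcts (@prod_fun_continuous a b f).

Local Lemma prod_smap1 (a : C) (p : prod_sp a) : prod_smap (idm a) p = p.
Proof. by case: p => x y; rewrite /= /mkcts /prod_fun /= !smap1. Qed.

Local Lemma prod_smapM (a b c : C) (g : mor b c) (f : mor a b) (p : prod_sp a) :
  prod_smap (compm g f) p = prod_smap g (prod_smap f p).
Proof. by case: p => x y; rewrite /= /mkcts /prod_fun /= !smapM. Qed.

Definition prod_cspace : cspace C := CSpace prod_smap1 prod_smapM.

End Prod.

Section Representable.
Variable c : C.

Local Definition rep_sp (d : C) : cgType := discrete_topology {classic mor c d}.

Local Definition rep_fun (a b : C) (f : mor a b) (h : rep_sp a) : rep_sp b :=
  compm f h.

Local Lemma rep_fun_continuous (a b : C) (f : mor a b) : continuous (rep_fun f).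
Proof. by apply/continuousP => A _; exact: discrete_open. Qed.

Local Definition rep_smap (a b : C) (f : mor a b) :
  continuousType (rep_sp a) (rep_sp b) :=
  mkcts (@rep_fun_continuous a b f).

Local Lemma rep_smap1 (a : C) (h : rep_sp a) : rep_smap (idm a) h = h.
Proof. exact: comp1m. Qed.

Local Lemma rep_smapM (a b d : C) (g : mor b d) (f : mor a b) (h : rep_sp a) :
  rep_smap (compm g f) h = rep_smap g (rep_smap f h).
Proof. by rewrite /= /mkcts /rep_fun compmA. Qed.

Definition representable : cspace C := CSpace rep_smap1 rep_smapM.

End Representable.

Definition homotopic (R : realType) (X Y : cspace C) (f g : cmap X Y) : Prop :=
  exists H : cmap (prod_cspace X (const_cspace (unit_interval R))) Y,
    forall (c : C) (x : X c), H c (x, I0 R) = f c x /\ H c (x, I1 R) = g c x.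

Definition is_cocone (T : cspace C) (L : cgType)
    (l : forall c : C, continuousType (T c) L) : Prop :=
  forall (a b : C) (f : mor a b) (x : T a), l b (smap T f x) = l a x.

Definition is_colimit (T : cspace C) (L : cgType)
    (l : forall c : C, continuousType (T c) L) : Prop :=
  is_cocone l /\
  forall (Y : cgType) (m : forall c : C, continuousType (T c) Y),
    is_cocone m ->
    exists! h : continuousType L Y, forall (c : C) (x : T c), h (l c x) = m c x.

Definition is_orbit (T : cspace C) : Prop :=
  exists (L : cgType) (l : forall c : C, continuousType (T c) L),
    is_colimit l /\ homeomorphic L one_point.

Record orbit_family := OrbitFamily {
  in_family :> cspace C -> Prop;
  family_orbit : forall T : cspace C, in_family T -> is_orbit T;
  family_iso : forall T T' : cspace C,
    cspace_iso T T' -> in_family T -> in_family T';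
  family_representable : forall c : C, in_family (representable c)
}.

Record open_csubspace (X : cspace C) := OpenCSubspace {
  osub :> forall c : C, set (X c);
  osub_open : forall c : C, open (@osub c);
  osub_stable : forall (a b : C) (f : mor a b) (x : X a),
    @osub a x -> @osub b (smap X f x)
}.

Section OpenSub.
Variables (X : cspace C) (U : open_csubspace X).

Local Definition sub_sp (c : C) : cgType := kify (set_type (U c)).

Local Lemma sub_mem (a b : C) (f : mor a b) (x : sub_sp a) :
  smap X f (set_val x) \in U b.
Proof. by apply/mem_set/osub_stable; exact: (set_valP x). Qed.

Local Definition sub_fun (a b : C) (f : mor a b) (x : sub_sp a) : sub_sp b :=
  SigSub (sub_mem f x).

Local Lemma sub_fun_continuous (a b : C) (f : mor a b) : continuous (sub_fun f).
Proof.
apply: (@kify_continuous (set_type (U a)) (set_type (U b)) (sub_fun f)).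
apply/continuousP => _ [A oA <-].
rewrite -comp_preimage.
suff /continuousP : continuous (smap X f \o (set_val : U a -> X a)) by exact.
move=> x; apply: continuous_comp; first exact: initial_continuous.
exact: cts_fun.
Qed.

Local Definition sub_smap (a b : C) (f : mor a b) :
  continuousType (sub_sp a) (sub_sp b) :=
  mkcts (@sub_fun_continuous a b f).

Local Lemma sub_smap1 (a : C) (x : sub_sp a) : sub_smap (idm a) x = x.
Proof. by apply: val_inj => /=; rewrite smap1. Qed.

Local Lemma sub_smapM (a b c : C) (g : mor b c) (f : mor a b) (x : sub_sp a) :
  sub_smap (compm g f) x = sub_smap g (sub_smap f x).
Proof. by apply: val_inj => /=; rewrite smapM. Qed.

Definition csubspace : cspace C := CSpace sub_smap1 sub_smapM.

Local Lemma incl_fun_continuous (c : C) :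
  continuous (set_val : csubspace c -> X c).
Proof.
move=> x.
apply: (@continuous_comp (kify (set_type (U c))) (set_type (U c)) (X c) id).
  exact: kify_id_continuous.
exact: initial_continuous.
Qed.

Local Definition incl_fun (c : C) : continuousType (csubspace c) (X c) :=
  mkcts (@incl_fun_continuous c).

Local Lemma incl_nat (a b : C) (f : mor a b) (x : csubspace a) :
  incl_fun b (smap csubspace f x) = smap X f (incl_fun a x).
Proof. by []. Qed.

Definition csubspace_incl : cmap csubspace X := CMap incl_nat.

End OpenSub.

Definition categorical (R : realType) (O : orbit_family) (X : cspace C)
    (U : open_csubspace X) : Prop :=
  exists T : cspace C, O T /\
  exists (a : cmap (csubspace U) T) (o : cmap T X),
    homotopic R (csubspace_incl U) (cmap_comp o a).

Definition has_categorical_cover (R : realType) (O : orbit_family)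
    (X : cspace C) (n : nat) : Prop :=
  exists U : 'I_n.+1 -> open_csubspace X,
    (forall (c : C) (x : X c), exists i, U i c x) /\
    (forall i, categorical R O (U i)).

Definition orbit_cat (R : realType) (O : orbit_family) (X : cspace C) :
    \bar int :=
  if pselect (exists n, `[< has_categorical_cover R O X n >]) is left ex
  then (Posz (ex_minn ex))%:E else +oo%E.

End CSpaces.

Section Restriction.
Variables (C D : category) (F : functor C D) (X : cspace D).

Local Definition restr_smap (a b : C) (f : mor a b) :
  continuousType (X (F a)) (X (F b)) :=
  smap X (fun_map F f).

Local Lemma restr_smap1 (a : C) (x : X (F a)) : restr_smap (idm a) x = x.
Proof. by rewrite /restr_smap fun_map1 smap1. Qed.

Local Lemma restr_smapM (a b c : C) (g : mor b c) (f : mor a b) (x : X (F a)) :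
  restr_smap (compm g f) x = restr_smap g (restr_smap f x).
Proof. by rewrite /restr_smap fun_mapM smapM. Qed.

Definition restr : cspace C :=
  @CSpace C (fun c => X (F c)) _ restr_smap1 restr_smapM.

End Restriction.

(* Main.v *)
Require Import Defs.
From HB Require Import structures.
From mathcomp Require Import all_boot all_order all_algebra.
From mathcomp Require Import all_classical all_reals all_analysis.
Set Implicit Arguments.
Unset Strict Implicit.
Unset Printing Implicit Defensive.

(** Restriction along [F] carries every ingredient of a categorical cover of
    [X] to the same ingredient for [F^* X].  Open subspaces, covers, maps and
    homotopies are all objectwise data, so evaluating them at [F c] instead of
    [d] gives the restricted data; naturality along [f] in [C] is naturality
    along [F f] in [D].  If [U] deforms in [X] through an orbit [T] of [O], then
    [F^* U] deforms in [F^* X] through [F^* T], which lies in [P] because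
    [F^* O] is contained in [P] ([categorical_restr]).  A categorical cover by
    [n + 1] sets therefore restricts to a categorical cover by [n + 1] sets
    ([has_categorical_cover_restr]), and comparing the least such [n] on both
    sides gives the inequality. *)

Section Restriction.
Variables (C D : category) (F : functor C D).

Section RestrMap.
Variables (X Y : cspace D) (f : cmap X Y).

Let restr_cmap_fun (c : C) : continuousType (restr F X c) (restr F Y c) :=
  f (F c).

Let restr_cmap_nat (a b : C) (h : mor a b) (x : restr F X a) :
  restr_cmap_fun b (smap (restr F X) h x)
  = smap (restr F Y) h (restr_cmap_fun a x).
Proof. exact: (cmap_nat f (fun_map F h) x). Qed.

Definition restr_cmap : cmap (restr F X) (restr F Y) := CMap restr_cmap_nat.

End RestrMap.

Section RestrOpen.
Variables (X : cspace D) (U : open_csubspace X).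

Definition restr_open : open_csubspace (restr F X) :=
  @OpenCSubspace C (restr F X) (fun c => U (F c))
    (fun c => @osub_open _ _ U (F c))
    (fun a b f x => @osub_stable _ _ U _ _ (fun_map F f) x).

Let restr_sub_fun (c : C) :
  continuousType (csubspace restr_open c) (restr F (csubspace U) c) := idfun.

Let restr_sub_nat (a b : C) (f : mor a b) (x : csubspace restr_open a) :
  restr_sub_fun b (smap (csubspace restr_open) f x)
  = smap (restr F (csubspace U)) f (restr_sub_fun a x).
Proof. exact: val_inj. Qed.

(** Restricting and passing to the open subspace commute: the two [C]-spaces
    have the same value at each object, but their structure maps carry different
    proofs of membership in [U], so the comparison has to be a map rather than
    a conversion. *)
Definition restr_csubspace :
  cmap (csubspace restr_open) (restr F (csubspace U)) := CMap restr_sub_nat.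

End RestrOpen.

(** The restricted homotopy is the value at [F c] of the given one: the product
    with the interval is formed objectwise, so the cylinders on [F^* U] and on
    [U] have the same space at [c] and at [F c]. *)
Lemma categorical_restr (R : realType) (O : orbit_family D)
    (P : orbit_family C) (X : cspace D) (U : open_csubspace X) :
  (forall T : cspace D, O T -> P (restr F T)) ->
  categorical R O U -> categorical R P (restr_open U).
Proof.
move=> FOP [T [OT [a [e [H Hends]]]]].
exists (restr F T); split; first exact: FOP.
exists (cmap_comp (restr_cmap a) (restr_csubspace U)), (restr_cmap e).
pose cyl := prod_cspace (csubspace (restr_open U))
  (const_cspace C (unit_interval R)).
pose K (c : C) : continuousType (cyl c) (restr F X c) := H (F c).
have K_nat (b c : C) (f : mor b c) (p : cyl b) :
    K c (smap cyl f p) = smap (restr F X) f (K b p).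
  (* the two cylinder structure maps agree up to the proof of membership in U *)
  rewrite /= -[RHS](cmap_nat H); congr (H (F c) _).
  by congr (_, _); exact: val_inj.
exists (CMap K_nat) => c x; exact: (Hends (F c) x).
Qed.

Lemma has_categorical_cover_restr (R : realType) (O : orbit_family D)
    (P : orbit_family C) (X : cspace D) (n : nat) :
  (forall T : cspace D, O T -> P (restr F T)) ->
  has_categorical_cover R O X n ->
  has_categorical_cover R P (restr F X) n.
Proof.
move=> FOP [U [Ucover Ucat]].
exists (fun i => restr_open (U i)); split.
  by move=> c x; exact: (Ucover (F c) x).
by move=> i; exact: (categorical_restr FOP (Ucat i)).
Qed.

End Restriction.

(** [orbit_cat] is a least element, so it is monotone for inclusion of the sets
    of admissible cover sizes; it is [+oo] when there is none. *)
Lemma le_orbit_cat (R : realType) (C D : category) (P : orbit_family C)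
    (O : orbit_family D) (Y : cspace C) (X : cspace D) :
  (forall n, has_categorical_cover R O X n -> has_categorical_cover R P Y n) ->
  (orbit_cat R P Y <= orbit_cat R O X)%E.
Proof.
move=> sub; rewrite /orbit_cat.
case: (pselect (exists n, `[< has_categorical_cover R O X n >])) => [exX|_];
  last by rewrite leey.
case: (pselect _) => [exY|noY]; last first.
  by case: noY; case: exX => n /asboolP Xn; exists n; apply/asboolP/sub.
rewrite lee_fin lez_nat.
case: (ex_minnP exX) => n /asboolP Xn _.
by case: (ex_minnP exY) => m _; apply; apply/asboolP/sub.
Qed.

Theorem theorem6p3 (R : realType) (C D : category) (F : functor C D)
    (O : orbit_family D) (P : orbit_family C)
    (FOP : forall T : cspace D, O T -> P (restr F T))
    (X : cspace D) :
  (orbit_cat R P (restr F X) <= orbit_cat R O X)%E.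
Proof.
by apply: le_orbit_cat => n; exact: (has_categorical_cover_restr FOP).
Qed.
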